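(* Consider the closed-loop system, for $t\in\mathbb{Z}_+$, $$X_{t+1}=\mathcal{A}(X_t)+\mathcal{B}\bigl(\Theta\Psi(X_t,t)+U_t\bigr),\qquad U_t=-\mathcal{K}(X_t)-\widehat{\Theta}_t\Psi(X_t,t)+U_t^{\mathrm d},$$ with arbitrary initial state $X_0\in\mathbb{R}^{n_1\times n_2}$, where the estimates $\widehat\Theta_t$ are generated, from an initial estimate $\widehat{\Theta}_0$ with $\partial f(\widehat\Theta_0)\neq\varnothing$ and any $Z_0\in\partial f(\widehat{\Theta}_0)$, by $$Z_{t+1}=Z_t-\eta_{t+1}\nabla J_t(\widehat{\Theta}_t),\qquad \widehat{\Theta}_{t+1}=\nabla f^*(Z_{t+1}),\qquad \eta_{t+1}=\frac{2\mu J_t(\widehat{\Theta}_t)}{\epsilon_{t+1}+\|\nabla J_t(\widehat{\Theta}_t)\|_*^2},$$ for a nonnegative bounded sequence $\{\epsilon_{t+1}\}_{t\in\mathbb{Z}_+}$. Let $\{X_t^{\mathrm d}\}$ be the reference trajectory $X^{\mathrm d}_{t+1}=(\mathcal{A}-\mathcal{B}\mathcal{K})(X^{\mathrm d}_t)+\mathcal{B}(U^{\mathrm d}_t)$, with arbitrary $X_0^{\mathrm d}\in\mathbb{R}^{n_1\times n_2}$. Suppose there are constants $c_1,c_2\ge 0$ such that $$\|\Psi(X,t)\|\le c_1+c_2\|X\|\qquad\text{for all }(X,t)\in\mathbb{R}^{n_1\times n_2}\times\mathbb{Z}_+ .$$ Then the sequences $\{X_t\}_{t\ge0}$ and $\{\widehat{\Theta}_t\}_{t\ge0}$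 are uniformly bounded, and $$\lim_{t\to\infty}\|X_t-X_t^{\mathrm d}\|_{\mathrm F}=0 .$$
   Context: Fix positive integers $n_1,n_2,m,k$. Matrix spaces carry the Frobenius inner product $\langle X,Y\rangle=\operatorname{Tr}(X^\top Y)$ and Frobenius norm $\|\cdot\|_{\mathrm F}$. $\mathcal{A}:\mathbb{R}^{n_1\times n_2}\to\mathbb{R}^{n_1\times n_2}$, $\mathcal{B}:\mathbb{R}^{m\times n_2}\to\mathbb{R}^{n_1\times n_2}$ and $\mathcal{K}:\mathbb{R}^{n_1\times n_2}\to\mathbb{R}^{m\times n_2}$ are linear operators such that $\mathcal{A}-\mathcal{B}\mathcal{K}$ (i.e. $X\mapsto\mathcal{A}(X)-\mathcal{B}(\mathcal{K}(X))$) is Schur stable (spectral radius $<1$). $\mathcal{B}^\top$ is the adjoint of $\mathcal{B}$: $\langle\mathcal{B}(U),V\rangle=\langle U,\mathcal{B}^\top(V)\rangle$. $\Psi:\mathbb{R}^{n_1\times n_2}\times\mathbb{Z}_+\to\mathbb{R}^{k\times n_2}$ is a map (the regressor), $\{U_t^{\mathrm d}\}_{t\in\mathbb{Z}_+}\subset\mathbb{R}^{m\times n_2}$ is a bounded sequence, and $\Theta\in\Omega\subseteq\mathbb{R}^{m\times k}$ is the fixed true parameter. In the growth condition on $\Psi$, the norms may be taken to be Frobenius norms (all norms being equivalent). Residual, loss and gradient: $$\widetilde X_{t+1}:=X_{t+1}-(\mathcal{A}-\mathcal{B}\mathcal{K})(X_t)-\mathcal{B}(U_t^{\mathrm d})=\mathcal{B}\bigl((\Theta-\widehat\Theta_t)\Psi(X_t,t)\bigr),$$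 $$J_t(\widehat\Theta_t):=\tfrac12\bigl\|\mathcal{B}\bigl((\Theta-\widehat\Theta_t)\Psi(X_t,t)\bigr)\bigr\|_{\mathrm F}^2=\tfrac12\|\widetilde X_{t+1}\|_{\mathrm F}^2,\qquad \nabla J_t(\widehat\Theta_t)=-\mathcal{B}^\top(\widetilde X_{t+1})\Psi(X_t,t)^\top .$$ Mirror map: $\|\cdot\|$ is a norm on $\mathbb{R}^{m\times k}$ with dual norm $\|Z\|_*=\sup\{\langle Z,X\rangle:\|X\|\le1\}$. $f:\mathbb{R}^{m\times k}\to\mathbb{R}\cup\{+\infty\}$ is proper, lower semicontinuous, convex, with $\Omega\subseteq\operatorname{dom}f$ (so $\Theta\in\operatorname{dom} f$), not necessarily differentiable, and $\mu$-strongly convex ($\mu>0$) with respect to $\|\cdot\|$: $f(P)\ge f(Q)+\langle Z,P-Q\rangle+\frac\mu2\|P-Q\|^2$ for all $P,Q\in\operatorname{dom}f$ and $Z\in\partial f(Q)$. $f^*(Z)=\sup_{X\in\operatorname{dom}f}\{\langle Z,X\rangle-f(X)\}$ is its Fenchel conjugate, which is differentiable everywhere. Convention: if the denominator in the step size is zero (in which case $J_t(\widehat\Theta_t)=0$ too), set $\eta_{t+1}=0$. *)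

(* Defs.v *)
From HB Require Import structures.
From mathcomp Require Import all_boot all_order all_algebra.
From mathcomp Require Import complex ring.
From mathcomp Require Import all_classical all_reals all_analysis.

Set Implicit Arguments.
Unset Strict Implicit.
Unset Printing Implicit Defensive.

Import Order.TTheory GRing.Theory Num.Theory.
Import numFieldNormedType.Exports.

Local Open Scope classical_set_scope.
Local Open Scope ring_scope.

Definition frob_inner (R : realType) (p q : nat) (X Y : 'M[R]_(p, q)) : R :=
  \tr (X^T *m Y).

Definition frob_norm (R : realType) (p q : nat) (X : 'M[R]_(p, q)) : R :=
  Num.sqrt (frob_inner X X).

(* Meaningful for linear L: [lin_mx L] is the matrix of L in the canonical
   basis (acting on row vectors), viewed over the complex numbers R[i] so as
   to account for non-real eigenvalues. *)
Definition spectral_radius (R : realType) (p q : nat)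
    (L : 'M[R]_(p, q) -> 'M[R]_(p, q)) : R :=
  sup [set r : R | exists2 z : R[i],
    eigenvalue (map_mx (real_complex R) (lin_mx L)) z & ComplexField.Normc.normc z = r].

Definition schur_stable (R : realType) (p q : nat)
    (L : 'M[R]_(p, q) -> 'M[R]_(p, q)) : Prop :=
  spectral_radius L < 1.

Definition is_norm (R : realType) (p q : nat) (N : 'M[R]_(p, q) -> R) : Prop :=
  [/\ forall X Y, N (X + Y) <= N X + N Y,
      forall (a : R) X, N (a *: X) = `|a| * N X &
      forall X, N X = 0 -> X = 0].

Definition dual_norm (R : realType) (p q : nat) (N : 'M[R]_(p, q) -> R)
    (Z : 'M[R]_(p, q)) : R :=
  sup [set frob_inner Z X | X in [set X | N X <= 1]].

(* Riesz representative, for the Frobenius inner product, of the Frechet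
   differential of g at X; meaningful when g is differentiable at X. *)
Definition grad (R : realType) (p q : nat) (g : 'M[R]_(p, q) -> R)
    (X : 'M[R]_(p, q)) : 'M[R]_(p, q) :=
  \matrix_(i, j) ('d g X (delta_mx i j)).

Section ConvexAnalysis.
Local Open Scope ereal_scope.

Definition edom (R : realType) (p q : nat) (f : 'M[R]_(p, q) -> \bar R)
  : set 'M[R]_(p, q) := [set X | f X < +oo].

Definition eproper (R : realType) (p q : nat) (f : 'M[R]_(p, q) -> \bar R)
  : Prop := (forall X, f X != -oo) /\ edom f !=set0.

Definition econvex (R : realType) (p q : nat) (f : 'M[R]_(p, q) -> \bar R)
  : Prop :=
  forall (X Y : 'M[R]_(p, q)) (s : R), (0 <= s <= 1)%R ->
    f (s *: X + (1 - s) *: Y)%R <= s%:E * f X + (1 - s)%:E * f Y.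

Definition subdiff (R : realType) (p q : nat) (f : 'M[R]_(p, q) -> \bar R)
    (Q : 'M[R]_(p, q)) : set 'M[R]_(p, q) :=
  [set Z | edom f Q /\
    forall P, f Q + (frob_inner Z (P - Q))%:E <= f P].

Definition strongly_convex (R : realType) (p q : nat)
    (N : 'M[R]_(p, q) -> R) (mu : R) (f : 'M[R]_(p, q) -> \bar R) : Prop :=
  forall P Q Z : 'M[R]_(p, q), edom f P -> edom f Q -> subdiff f Q Z ->
    f Q + (frob_inner Z (P - Q) + mu / 2 * N (P - Q) ^+ 2)%:E <= f P.

Definition fenchel (R : realType) (p q : nat) (f : 'M[R]_(p, q) -> \bar R)
    (Z : 'M[R]_(p, q)) : \bar R :=
  ereal_sup [set (frob_inner Z X)%:E - f X | X in edom f].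

End ConvexAnalysis.

(* [grad] applies to real-valued functions; the conjugate of a proper, lower
   semicontinuous, strongly convex function is finite everywhere, so [fine]
   loses nothing. *)
Definition mirror_map (R : realType) (m k : nat) (f : 'M[R]_(m, k) -> \bar R)
    : 'M[R]_(m, k) -> 'M[R]_(m, k) :=
  grad (fun Z => fine (fenchel f Z)).

(* W stands for the regressor value. *)
Definition loss (R : realType) (n1 n2 m k : nat)
    (B : 'M[R]_(m, n2) -> 'M[R]_(n1, n2)) (Theta : 'M[R]_(m, k))
    (W : 'M[R]_(k, n2)) (P : 'M[R]_(m, k)) : R :=
  1 / 2 * frob_norm (B ((Theta - P) *m W)) ^+ 2.

(* When the denominator vanishes the value is 0, because 0^-1 = 0. *)
Definition step_size (R : realType) (m k : nat) (N : 'M[R]_(m, k) -> R)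
    (mu eps J : R) (G : 'M[R]_(m, k)) : R :=
  2 * mu * J / (eps + dual_norm N G ^+ 2).

Lemma frob_innerE (R : realType) (p q : nat) (X Y : 'M[R]_(p, q)) :
  frob_inner X Y = \sum_i \sum_j X i j * Y i j.
Proof.
rewrite /frob_inner /mxtrace exchange_big; apply: eq_bigr => j _.
by rewrite mxE; apply: eq_bigr => i _; rewrite mxE.
Qed.

Lemma frob_inner_delta (R : realType) (p q : nat) (X : 'M[R]_(p, q)) i j :
  frob_inner X (delta_mx i j) = X i j.
Proof.
rewrite frob_innerE (bigD1 i)//= (bigD1 j)//= !mxE !eqxx mulr1.
rewrite !big1 ?addr0// => [i' /negPf ne|j' /negPf ne].
  by rewrite big1// => j' _; rewrite mxE ne mulr0.
by rewrite mxE ne andbF mulr0.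
Qed.

Lemma frob_norm_sqr (R : realType) (p q : nat) (X : 'M[R]_(p, q)) :
  frob_norm X ^+ 2 = frob_inner X X.
Proof.
rewrite sqr_sqrtr// frob_innerE; apply: sumr_ge0 => i _; apply: sumr_ge0 => j _.
by rewrite -expr2 sqr_ge0.
Qed.

Lemma diff_grad (R : realType) (p q : nat) (g : 'M[R]_(p, q) -> R) X H :
  'd g X H = frob_inner (grad g X) H.
Proof.
rewrite frob_innerE {1}(matrix_sum_delta H) linear_sum; apply: eq_bigr => i _.
by rewrite linear_sum; apply: eq_bigr => j _; rewrite linearZ mxE mulrC.
Qed.

(* Closed form of the gradient of the loss, with Bt the adjoint of B. *)
Lemma grad_loss (R : realType) (n1 n2 m k : nat)
  (B : {linear 'M[R]_(m, n2) -> 'M[R]_(n1, n2)})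
  (Bt : 'M[R]_(n1, n2) -> 'M[R]_(m, n2)) Theta (W : 'M[R]_(k, n2)) P :
  (forall U V, frob_inner (B U) V = frob_inner U (Bt V)) ->
  grad (loss B Theta W) P = - (Bt (B ((Theta - P) *m W)) *m W^T).
Proof.
move=> BtE.
pose L X := B (X *m W).
have LD X Y : L (X + Y) = L X + L Y by rewrite /L mulmxDl linearD.
have LZ a X : L (a *: X) = a *: L X by rewrite /L -scalemxAl linearZ.
have lossE : loss B Theta W =
    (1 / 2) *: (\sum_i \sum_j (cst (L Theta i j) -
       \sum_a \sum_b (L (delta_mx a b) i j) *: (fun X : 'M[R]_(m, k) => X a b : R)) ^+ 2).
  apply/funext => X; rewrite /loss frob_norm_sqr frob_innerE.
  rewrite fctE /=; congr (_ * _).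
  rewrite fct_sumE; apply: eq_bigr => i _; rewrite fct_sumE; apply: eq_bigr => j _.
  rewrite expr2 /= -/(L (Theta - X)).
  suff -> : L (Theta - X) i j = (cst (L Theta i j) -
     \sum_a \sum_b (L (delta_mx a b) i j) *: (fun X : 'M[R]_(m, k) => X a b : R)) X by [].
  rewrite -scaleN1r LD LZ !mxE mulN1r; congr (_ - _).
  rewrite {1}(matrix_sum_delta X) /L mulmx_suml linear_sum summxE fct_sumE.
  apply: eq_bigr => a _; rewrite mulmx_suml linear_sum summxE fct_sumE.
  by apply: eq_bigr => b _; rewrite -/(L _) LZ mxE mulrC.
have dsum n (F : 'I_n -> 'M[R]_(m, k) -> R) :
    (forall i, differentiable (F i) P) -> differentiable (\sum_i F i) P.
  move=> dF; elim/big_ind : _ => [|g h dg dh|i _]; last exact: dF.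
    exact: (@differentiable_cst _ _ _ (0 : R)).
  exact: differentiableD.
have dif : differentiable (loss B Theta W) P.
  rewrite lossE; apply: differentiableZ; apply: (dsum _ _) => i.
  apply: (dsum _ _) => j; apply: differentiableX.
  apply: differentiableB; first exact: differentiable_cst.
  apply: (dsum _ _) => a; apply: dsum => b.
  by apply: differentiableZ; exact: differentiable_coord.
have inC p q (S T : 'M[R]_(p, q)) : frob_inner S T = frob_inner T S.
  by rewrite /frob_inner -mxtrace_tr trmx_mul trmxK.
have inD p q (S T V : 'M[R]_(p, q)) :
    frob_inner S (T + V) = frob_inner S T + frob_inner S V.
  by rewrite /frob_inner mulmxDr mxtraceD.
have inZ p q (S T : 'M[R]_(p, q)) c : frob_inner S (c *: T) = c * frob_inner S T.
  by rewrite /frob_inner -scalemxAr mxtraceZ.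
apply/matrixP => i j; rewrite mxE -deriveE//.
set v := delta_mx i j.
rewrite -[RHS]frob_inner_delta -/v.
have -> : frob_inner (- (Bt (B ((Theta - P) *m W)) *m W^T)) v =
          - frob_inner (L (Theta - P)) (L v).
  rewrite [in RHS]inC BtE [in RHS]inC /frob_inner linearN mulNmx linearN; congr (- _).
  by rewrite /= trmx_mul trmxK -mulmxA mxtrace_mulC mulmxA.
apply: (@cvg_lim R) => //.
have cv : (fun h : R => - frob_inner (L (Theta - P)) (L v)
    + h * (1 / 2 * frob_inner (L v) (L v))) @ 0^' --> - frob_inner (L (Theta - P)) (L v).
  rewrite -[X in _ --> X]addr0; apply: cvgD; first exact: cvg_cst.
  rewrite -[X in _ --> X](mul0r (1 / 2 * frob_inner (L v) (L v))).
  by apply: cvgMr_tmp; apply: cvg_within_filter; exact: cvg_id.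
apply: cvg_trans cv; apply: near_eq_cvg; near=> h.
have h0 : h != 0 by near: h; exact: nbhs_dnbhs_neq.
rewrite /= /loss !frob_norm_sqr -!/(L _).
have -> : Theta - (h *: v + P) = (Theta - P) + (- h) *: v.
  by rewrite scaleNr opprD addrA addrAC.
rewrite [L (_ + _ *: _)]LD LZ; set M := L (Theta - P); set D := L v.
rewrite inD inZ [frob_inner (_ + _) M]inC [frob_inner (_ + _) D]inC !inD !inZ.
rewrite [frob_inner D M]inC /GRing.scale/=.
by field.
Unshelve. all: by end_near. Qed.

(* Main.v *)
From HB Require Import structures.
Require Import Defs.
From mathcomp Require Import all_boot all_order all_algebra.
From mathcomp Require Import complex finmap ring lra.
From mathcomp Require Import all_classical all_reals all_analysis.

Set Implicit Arguments.
Unset Strict Implicit.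
Unset Printing Implicit Defensive.

Import Order.TTheory GRing.Theory Num.Theory.
Import numFieldNormedType.Exports.

Local Open Scope classical_set_scope.
Local Open Scope ring_scope.

(** Write D_t = f(Theta) - f(hTheta_t) - <Z_t, Theta - hTheta_t> for the Bregman
    divergence attached to the subgradient Z_t, and r_t for the norm of the
    residual B((Theta - hTheta_t) Psi_t).  The proof combines a Lyapunov
    argument for the estimates with a small-gain argument for the states.

    The mirror map inverts the subdifferential.  One subgradient together with
    strong convexity makes f - <Z, .> coercive for every Z, so this lower
    semicontinuous function has a minimiser Q, that is, Z is a subgradient at Q
    ([subdiff_surjective]).  Strong convexity at Q then bounds the
    second-order remainder of f^* by a multiple of |H|^2, so that f^* is
    differentiable at Z with gradient Q ([mirror_map_subdiff]).  Hence Z_t is a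
    subgradient at hTheta_t for all t.

    The loss is quadratic, so <grad J_t, hTheta_t - Theta> = 2 J_t, and the
    step size is the one for which strong convexity gives
    D_{t+1} <= D_t - eta_{t+1} J_t ([mirror_descent_step]).  So D_t decreases;
    since it dominates mu/2 N(Theta - hTheta_t)^2, the estimates are bounded,
    and the decrements d_t = D_t - D_{t+1} tend to 0.  They control the loss
    through 2 mu J_t^2 <= d_t (eps_{t+1} + ||grad J_t||_*^2).  As
    ||grad J_t||_* <= C r_t |Psi_t| and Psi grows at most linearly, this gives
    r_t <= delta (1 + |X_t|) for every delta > 0 and all large t
    ([small_relative_residual]): the residual is small relative to the state
    even before the state is known to be bounded.

    The tracking error satisfies E_{t+1} = L E_t + w_t with L = A - B K and
    |w_t| <= r_t.  By Cayley-Hamilton over the complex numbers the orbits of a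
    Schur stable L tend to 0; so some power of L halves the norm, and summing
    the norm along the orbit gives an equivalent gauge that L contracts
    ([schur_stable_contracting_gauge]).  A contraction perturbed by a
    vanishing fraction of the state still converges to 0
    ([perturbed_contraction_cvg0]), so E_t tends to 0, and X_t is bounded
    because the reference trajectory is.

    All estimates are made in the entrywise maximum norm that matrices carry
    as a normed module; it is equivalent to the Frobenius norm and to N. *)

(** * The maximum norm on matrices *)

Lemma normr_entry_le (R : realType) (p q : nat) (X : 'M[R]_(p, q)) i j :
  `|X i j| <= `|X|.
Proof.
rewrite [leRHS]/Num.norm /= mx_normrE; apply/bigmax_geP; right => /=.
by exists (i, j).
Qed.

Lemma normr_mx_le (R : realType) (p q : nat) (X : 'M[R]_(p, q)) (c : R) :
  0 <= c -> (forall i j, `|X i j| <= c) -> `|X| <= c.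
Proof.
move=> c0 Xc; rewrite [leLHS]/Num.norm /= mx_normrE.
by apply/bigmax_leP; split => // -[i j] _; exact: Xc.
Qed.

(** A seminorm is determined up to a factor by its values on the standard basis;
    this bounds at once linear maps (through the norm of the image) and N. *)
Lemma seminorm_le_normr (R : realType) (p q : nat) (s : 'M[R]_(p, q) -> R) :
  (forall X Y, s (X + Y) <= s X + s Y) ->
  (forall a X, s (a *: X) = `|a| * s X) ->
  exists2 C, 0 <= C & forall X, s X <= C * `|X|.
Proof.
move=> sD sZ.
have s0 : s 0 = 0 by rewrite -(scale0r 0) sZ normr0 mul0r.
have s_ge0 X : 0 <= s X.
  have sN : s (- X) = s X by rewrite -scaleN1r sZ normrN1 mul1r.
  by have := sD X (- X); rewrite subrr s0 sN -mulr2n pmulrn_lge0.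
have s_sum n (F : 'I_n -> 'M[R]_(p, q)) : s (\sum_i F i) <= \sum_i s (F i).
  elim/big_ind2 : _ => [|x a y b xa yb|//]; first by rewrite s0.
  by apply: le_trans (sD _ _) _; exact: lerD.
exists (\sum_i \sum_j s (delta_mx i j)).
  by apply: sumr_ge0 => i _; apply: sumr_ge0 => j _.
move=> X; rewrite {1}(matrix_sum_delta X) mulr_suml.
apply: le_trans (s_sum _ _) _; apply: ler_sum => i _; rewrite mulr_suml.
apply: le_trans (s_sum _ _) _; apply: ler_sum => j _; rewrite sZ mulrC.
by rewrite ler_wpM2l// normr_entry_le.
Qed.

Lemma linear_mx_bounded (R : realType) (p q : nat) (V : normedModType R)
    (L : {linear 'M[R]_(p, q) -> V}) :
  exists2 C, 0 <= C & forall X, `|L X| <= C * `|X|.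
Proof.
apply: (@seminorm_le_normr _ _ _ (fun X => `|L X|)) => [X Y|a X].
  by rewrite linearD ler_normD.
by rewrite linearZ normrZ.
Qed.

Lemma linear_mx_continuous (R : realType) (p q : nat) (V : normedModType R)
    (L : {linear 'M[R]_(p, q) -> V}) : continuous L.
Proof.
have [C C0 LC] := linear_mx_bounded L.
apply: bounded_linear_continuous; apply/linear_boundedP.
near=> r => X; apply: le_trans (LC X) _; rewrite ler_wpM2r//.
Unshelve. all: by end_near. Qed.

(** Heine-Borel transported from row vectors along the vectorisation of
    matrices, which preserves the maximum norm. *)
Lemma closed_ball_mx_compact (R : realType) (p q : nat) (r : R) :
  compact [set X : 'M[R]_(p, q) | `|X| <= r].
Proof.
have -> : [set X : 'M[R]_(p, q) | `|X| <= r] =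
    vec_mx @` [set v : 'rV[R]_(p * q) | `|v| <= r].
  apply/seteqP; split => [X /= Xr|_ [v /= vr <-]].
    exists (mxvec X); rewrite ?mxvecK //=.
    apply: normr_mx_le => [|i j]; first exact: le_trans Xr.
    case/mxvec_indexP: j => a b; rewrite (ord1 i) mxvecE.
    exact: le_trans (normr_entry_le _ _ _) Xr.
  apply: normr_mx_le => [|i j]; first exact: le_trans vr.
  by rewrite mxE; apply: le_trans (normr_entry_le _ _ _) vr.
apply: continuous_compact.
  apply: continuous_subspaceT; exact: linear_mx_continuous.
apply: bounded_closed_compact.
  exists r; split; first exact: num_real.
  by move=> x rx v /= vr; apply: le_trans vr (ltW rx).
have -> : [set v : 'rV[R]_(p * q) | `|v| <= r] =
    (fun v => `|v|) @^-1` [set x | x <= r] by [].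
apply: closed_comp => [v _|]; [exact: norm_continuous|exact: closed_le].
Qed.

(** * Semicontinuous minimisation and equivalence of norms *)

(** If no point were minimal, the open sets {g > g y}, for y in A, would cover A;
    but the best of the finitely many y of a subcover lies in none of them. *)
Lemma lower_semicontinuous_attains_min (R : realType) (T : ptopologicalType)
    (g : T -> \bar R) (A : set T) :
  lower_semicontinuous g -> (forall x, g x != -oo%E) ->
  compact A -> A !=set0 ->
  exists2 x, A x & forall y, A y -> (g x <= g y)%E.
Proof.
move=> /lower_semicontinuousP glsc gNy cA [a0 Aa0]; apply: contrapT => nomin.
have [] : finite_subset_cover A (fun y => [set x | (g y < g x)%E]) A.
- have := cA; rewrite compact_cover; apply => [y _|x Ax].
    have := gNy y; case: (g y) => [r _|_|//]; first exact: glsc.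
    rewrite (_ : [set x | _] = set0); first exact: open0.
    by rewrite -subset0 => x /=; rewrite ltNge leey.
  apply: contrapT => nx; apply: nomin; exists x => // y Ay.
  by rewrite leNgt; apply/negP => gyx; apply: nx; exists y.
move=> D DA AD; have [y0 Dy0 _] := AD _ Aa0.
case: (@arg_minP _ _ _ [` Dy0]%fset xpredT (fun y => g (val y)) isT) => i _ imin.
have /set_mem Ai : val i \in A by exact: DA (valP i).
have [y Dy] := AD _ Ai; rewrite /= ltNge => /negP; apply.
exact: (imin [` Dy]%fset).
Qed.

Lemma lower_semicontinuousD (R : realType) (T : topologicalType)
    (g : T -> \bar R) (h : T -> R) :
  lower_semicontinuous g -> (forall x, g x != -oo%E) -> continuous h ->
  lower_semicontinuous (fun x => g x + (h x)%:E)%E.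
Proof.
move=> glsc gNy hc x a agh.
have [d d0 adg] : exists2 d : R, 0 < d & ((a + d - h x)%:E < g x)%E.
  move: agh (gNy x); case: (g x) => [r|_ _|//]; last first.
    by exists 1 => //; rewrite ltry.
  rewrite -EFinD lte_fin => arh _; exists ((r + h x - a) / 2); first by lra.
  by rewrite lte_fin; lra.
have [V Vx gV] := glsc _ _ adg.
exists (V `&` [set y | h x - d < h y]).
  apply: filterI => //; apply: (cvgr_gt (h x) (hc x)).
  by lra.
move=> y [/gV + /= hy]; case: (g y) => [r| |//]; last by rewrite addye ?ltry.
by rewrite -EFinD !lte_fin; lra.
Qed.

Lemma norm_continuous_mx (R : realType) (p q : nat) (N : 'M[R]_(p, q) -> R) :
  is_norm N -> continuous N.
Proof.
move=> [ND NZ _] X; have [C C0 NC] := seminorm_le_normr ND NZ.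
have NBl Y Z : N Y - N Z <= C * `|Y - Z|.
  by have := ND (Y - Z) Z; rewrite subrK; have := NC (Y - Z); lra.
apply/(@cvgrPdist_le R R _ (nbhs X) (nbhs_filter X)) => e e0; near=> Y.
have XY : C * `|X - Y| <= e.
  have dXY : `|X - Y| <= e / (C + 1).
    near: Y; apply: cvgr_dist_le; first exact: cvg_id.
    by rewrite divr_gt0// ltr_wpDl.
  have C1 : 0 < C + 1 by rewrite ltr_wpDl.
  apply: le_trans (_ : (C + 1) * `|X - Y| <= _).
    by rewrite ler_wpM2r// lerDl.
  by rewrite mulrC -ler_pdivlMr.
have := NBl X Y; have := NBl Y X; rewrite (distrC Y X) ler_norml; lra.
Unshelve. all: by end_near. Qed.

Lemma norm_mx0 (R : realType) (p q : nat) (N : 'M[R]_(p, q) -> R) :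
  is_norm N -> N 0 = 0.
Proof. by move=> [_ NZ _]; rewrite -(scale0r 0) NZ normr0 mul0r. Qed.

Lemma norm_ge0_mx (R : realType) (p q : nat) (N : 'M[R]_(p, q) -> R) X :
  is_norm N -> 0 <= N X.
Proof.
move=> Nn; have [ND NZ _] := Nn.
have NN : N (- X) = N X by rewrite -scaleN1r NZ normrN1 mul1r.
by have := ND X (- X); rewrite subrr norm_mx0// NN -mulr2n pmulrn_lge0.
Qed.

(** N has a positive minimum on the compact unit sphere of the maximum norm. *)
Lemma normr_le_norm_mx (R : realType) (p q : nat) (N : 'M[R]_(p, q) -> R) :
  is_norm N -> exists2 C, 0 <= C & forall X, `|X| <= C * N X.
Proof.
move=> Nn; have [_ NZ N0] := Nn.
have N_ge0 X : 0 <= N X by exact: norm_ge0_mx.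
have [[X0 X0_neq0]|all0] := pselect (exists X : 'M[R]_(p, q), X != 0); last first.
  exists 0 => // X; rewrite mul0r normr_le0; apply/negPn/negP => X0.
  by apply: all0; exists X.
have Sc : compact [set X : 'M[R]_(p, q) | `|X| = 1].
  apply: (subclosed_compact _ (@closed_ball_mx_compact _ _ _ 1)) => [|X /= ->//].
  rewrite (_ : [set X | _] = (fun X : 'M[R]_(p, q) => `|X|) @^-1` [set 1])//.
  apply: closed_comp => [v _|]; [exact: norm_continuous|exact: closed_eq].
have [] := @lower_semicontinuous_attains_min _ _ (EFin \o N) _ _ _ Sc.
- move=> X a; rewrite /= lte_fin => aN; exists (N @^-1` [set r | a < r]).
    exact: (norm_continuous_mx Nn (lt_nbhsr aN)).
  by move=> Y; rewrite /= lte_fin.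
- by [].
- exists (`|X0|^-1 *: X0); rewrite /= normrZ normfV normr_id.
  by rewrite mulVf// normr_eq0.
move=> Y /= Y1 NY.
have NY0 : 0 < N Y.
  rewrite lt_neqAle N_ge0 andbT eq_sym; apply/eqP => /N0 Y0.
  by move: Y1; rewrite Y0 normr0 => /eqP; rewrite eq_sym oner_eq0.
exists (N Y)^-1 => [|X]; first by rewrite invr_ge0 ltW.
have [->|X_neq0] := eqVneq X 0; first by rewrite normr0 mulr_ge0 // invr_ge0.
have X_gt0 : 0 < `|X| by rewrite normr_gt0.
have := NY (`|X|^-1 *: X); rewrite /= lee_fin NZ normfV normr_id => NYX.
rewrite ler_pdivlMl// -ler_pdivlMr// mulrC; apply: NYX.
by rewrite normrZ normfV normr_id mulVf// gt_eqF.
Qed.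

(** * The Frobenius inner product and dual norms *)

Lemma frob_innerC (R : realType) (p q : nat) (S T : 'M[R]_(p, q)) :
  frob_inner S T = frob_inner T S.
Proof. by rewrite /frob_inner -mxtrace_tr trmx_mul trmxK. Qed.

Lemma frob_inner_is_linear (R : realType) (p q : nat) (S : 'M[R]_(p, q)) :
  linear (frob_inner S : 'M[R]_(p, q) -> R).
Proof.
by move=> a X Y; rewrite /frob_inner mulmxDr -scalemxAr mxtraceD mxtraceZ.
Qed.

HB.instance Definition _ (R : realType) (p q : nat) (S : 'M[R]_(p, q)) :=
  GRing.isLinear.Build R 'M[R]_(p, q) R _ (frob_inner S)
    (frob_inner_is_linear S).

Lemma frob_innerZr (R : realType) (p q : nat) a (S T : 'M[R]_(p, q)) :
  frob_inner S (a *: T) = a * frob_inner S T.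
Proof. exact: linearZ. Qed.

Lemma frob_innerBl (R : realType) (p q : nat) (S T V : 'M[R]_(p, q)) :
  frob_inner (S - T) V = frob_inner S V - frob_inner T V.
Proof. by rewrite frob_innerC linearB /= !(frob_innerC V). Qed.

Lemma frob_innerZl (R : realType) (p q : nat) a (S T : 'M[R]_(p, q)) :
  frob_inner (a *: S) T = a * frob_inner S T.
Proof. by rewrite frob_innerC frob_innerZr frob_innerC. Qed.

Lemma frob_inner_le_normr (R : realType) (p q : nat) (S T : 'M[R]_(p, q)) :
  `|frob_inner S T| <= (p * q)%:R * `|S| * `|T|.
Proof.
rewrite frob_innerE; apply: le_trans (ler_norm_sum _ _ _) _.
apply: le_trans (_ : \sum_(i < p) q%:R * (`|S| * `|T|) <= _); last first.
  by rewrite sumr_const card_ord -[leLHS]mulr_natl natrM !mulrA.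
apply: ler_sum => i _; apply: le_trans (ler_norm_sum _ _ _) _.
apply: le_trans (_ : \sum_(j < q) (`|S| * `|T|) <= _); last first.
  by rewrite sumr_const card_ord -[leLHS]mulr_natl.
by apply: ler_sum => j _; rewrite normrM ler_pM// normr_entry_le.
Qed.

Section DualNorm.
Variables (R : realType) (p q : nat) (N : 'M[R]_(p, q) -> R).
Hypothesis N_norm : is_norm N.
Implicit Types Z X : 'M[R]_(p, q).

(** The equivalence of norms is what makes the supremum defining the dual norm
    a genuine one, since [sup] is a default value on unbounded sets. *)
Lemma dual_norm_has_ubound Z :
  has_ubound [set frob_inner Z X | X in [set X | N X <= 1]].
Proof.
have [C C0 NC] := normr_le_norm_mx N_norm.
exists ((p * q)%:R * `|Z| * C) => _ [Y /= Y1 <-].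
apply: le_trans (ler_norm _) _; apply: le_trans (frob_inner_le_normr _ _) _.
apply: ler_wpM2l; first by rewrite mulr_ge0.
by apply: le_trans (NC Y) _; rewrite ler_piMr.
Qed.

Lemma frob_inner_le_dual_norm Z X : frob_inner Z X <= dual_norm N Z * N X.
Proof.
have [_ NZ N0] := N_norm.
have [->|X0] := eqVneq X 0.
  by rewrite linear0 norm_mx0// mulr0.
have NX0 : 0 < N X.
  rewrite lt_neqAle norm_ge0_mx// andbT eq_sym.
  by apply: contra X0 => /eqP/N0 ->.
rewrite -ler_pdivrMr// mulrC -frob_innerZr; apply: ub_le_sup.
  exact: dual_norm_has_ubound.
exists ((N X)^-1 *: X) => //=.
by rewrite NZ ger0_norm ?invr_ge0 ?(ltW NX0)// mulVf ?gt_eqF.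
Qed.

Lemma dual_norm_le Z (c : R) :
  (forall X, N X <= 1 -> frob_inner Z X <= c) -> dual_norm N Z <= c.
Proof.
move=> Zc; apply: ge_sup; last by move=> _ [Y /= Y1 <-]; exact: Zc.
exists 0, 0; rewrite ?linear0 //=.
by rewrite norm_mx0.
Qed.

Lemma dual_norm_ge0 Z : 0 <= dual_norm N Z.
Proof.
apply: ub_le_sup; first exact: dual_norm_has_ubound.
by exists 0; rewrite /= ?linear0// norm_mx0.
Qed.

End DualNorm.

(** * The mirror map inverts the subdifferential *)

Section MirrorMap.
Variables (R : realType) (p q : nat) (N : 'M[R]_(p, q) -> R) (mu : R).
Variable f : 'M[R]_(p, q) -> \bar R.
Hypotheses (N_norm : is_norm N) (mu_gt0 : 0 < mu).
Hypotheses (f_proper : eproper f) (f_lsc : lower_semicontinuous f).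
Hypothesis f_sconvex : strongly_convex N mu f.
Implicit Types P Q Z : 'M[R]_(p, q).

Lemma edom_fineK P : edom f P -> (fine (f P))%:E = f P.
Proof.
move=> domP; apply: fineK; rewrite fin_numE; have [fNy _] := f_proper.
by rewrite fNy /= -ltey.
Qed.

Lemma subdiff_quadratic_minorant Q Z P : subdiff f Q Z -> edom f P ->
  fine (f Q) + frob_inner Z (P - Q) + mu / 2 * N (P - Q) ^+ 2 <= fine (f P).
Proof.
move=> QZ domP; have [domQ _] := QZ.
have := f_sconvex domP domQ QZ.
by rewrite -(edom_fineK domP) -(edom_fineK domQ) -EFinD lee_fin addrA.
Qed.

Lemma subdiff_minorant Q Z P : subdiff f Q Z -> edom f P ->
  fine (f Q) + frob_inner Z (P - Q) <= fine (f P).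
Proof.
move=> QZ domP; apply: le_trans (subdiff_quadratic_minorant QZ domP).
by rewrite lerDl mulr_ge0 ?sqr_ge0// divr_ge0// ltW.
Qed.

(** The known subgradient Z0 at Q0 makes f - <Z, .> grow quadratically away from
    Q0, so its minimum over a large ball is a global one. *)
Lemma subdiff_surjective Q0 Z0 Z : subdiff f Q0 Z0 -> exists Q, subdiff f Q Z.
Proof.
move=> Q0Z0; have [domQ0 _] := Q0Z0; have [fNy _] := f_proper.
have [C C0 NC] := normr_le_norm_mx N_norm.
pose g P := (f P + (- frob_inner Z P)%:E)%E.
have glsc : lower_semicontinuous g.
  apply: lower_semicontinuousD => // x.
  apply: (@continuousN _ R _ (frob_inner Z) x); exact: linear_mx_continuous.
have gNy P : g P != -oo%E by rewrite /g; have := fNy P; case: (f P).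
pose a := (p * q)%:R * `|Z - Z0|.
have a0 : 0 <= a by rewrite mulr_ge0.
(* Beyond distance r the quadratic term of the minorant, which is at least
   mu/2 (n / (C + 1))^2 at distance n, outweighs the linear term a n. *)
pose r := 2 * a * (C + 1) ^+ 2 / mu.
have r0 : 0 <= r.
  by rewrite divr_ge0 ?(ltW mu_gt0)// mulr_ge0 ?sqr_ge0// mulr_ge0.
have coercive P : r < `|P - Q0| -> (g Q0 <= g P)%E.
  move=> rP; have [domP|ndomP] := pselect (edom f P); last first.
    have -> : g P = +oo%E; last by rewrite leey.
    have := ndomP; rewrite /edom /= /g => /negP; rewrite -leNgt leye_eq.
    by move=> /eqP ->.
  have := subdiff_quadratic_minorant Q0Z0 domP.
  rewrite /g -(edom_fineK domP) -(edom_fineK domQ0) -!EFinD lee_fin.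
  have := le_trans (ler_norm _) (frob_inner_le_normr (Z - Z0) (P - Q0)).
  rewrite -/a frob_innerBl !linearB /=.
  set n := `|P - Q0| in rP *; set nu := N (P - Q0) => h1 h2.
  have nnu : n <= (C + 1) * nu.
    by apply: le_trans (NC _) _; rewrite ler_wpM2r ?norm_ge0_mx// lerDl.
  have n_gt0 : 0 < n by exact: le_lt_trans rP.
  have h3 : a * n <= mu / 2 * nu ^+ 2.
    have C1 : 0 < (C + 1) ^+ 2 by rewrite exprn_gt0// ltr_wpDl.
    rewrite -(ler_pM2r C1).
    have h4 : n ^+ 2 <= (C + 1) ^+ 2 * nu ^+ 2.
      by rewrite -exprMn lerXn2r// ?nnegrE ?(ltW n_gt0)// (le_trans (ltW n_gt0)).
    have h5 : 2 * a * (C + 1) ^+ 2 <= n * mu by rewrite -ler_pdivrMr// ltW.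
    have h6 := ler_wpM2r (ltW n_gt0) h5.
    have h7 := ler_wpM2l (ltW mu_gt0) h4.
    by nra.
  by lra.
have [] := @lower_semicontinuous_attains_min _ _ g _ glsc gNy
  (@closed_ball_mx_compact R p q (`|Q0| + r)).
  by exists Q0; rewrite /= lerDl.
move=> Q /= Qr Qmin; have gQ0 : (g Q <= g Q0)%E by apply: Qmin; rewrite lerDl.
have gQ P : (g Q <= g P)%E.
  have [Pr|rP] := leP `|P| (`|Q0| + r); first exact: Qmin.
  apply: le_trans gQ0 (coercive P _).
  by have := ler_normD (P - Q0) Q0; rewrite subrK; lra.
have domQ : edom f Q.
  move: gQ0; rewrite /edom /= /g -(edom_fineK domQ0) -EFinD.
  by case: (f Q) => // x _; rewrite ltry.
exists Q; split=> // P; have := gQ P; rewrite /g linearB /=.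
rewrite -(edom_fineK domQ); have := fNy P; case: (f P) => [x _|_ _|//].
  by rewrite -!EFinD !lee_fin => ?; lra.
by rewrite leey.
Qed.

(** The equality case of the Fenchel-Young inequality. *)
Lemma fenchel_subdiff Q Z : subdiff f Q Z ->
  fine (fenchel f Z) = frob_inner Z Q - fine (f Q).
Proof.
move=> QZ; have [domQ _] := QZ.
suff -> : fenchel f Z = (frob_inner Z Q - fine (f Q))%:E by [].
apply/eqP; rewrite eq_le; apply/andP; split.
  apply: ge_ereal_sup => _ [P domP <-].
  rewrite -(edom_fineK domP) -EFinB lee_fin.
  by have := subdiff_minorant QZ domP; rewrite linearB /=; lra.
apply: ereal_sup_ubound; exists Q => //.
by rewrite -(edom_fineK domQ) -EFinB.
Qed.

(** With Q' a minimiser for Z + H, the remainder f^*(Z+H) - f^*(Z) - <Q, H> is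
    nonnegative since Q competes in the supremum at Z + H, and strong convexity
    at Q bounds it by <H, Q' - Q> - mu/2 N(Q' - Q)^2, hence by O(|H|^2). *)
Lemma mirror_map_subdiff Q Z : subdiff f Q Z -> mirror_map f Z = Q.
Proof.
move=> QZ; have [domQ _] := QZ; have [C C0 NC] := normr_le_norm_mx N_norm.
have inner_cont : continuous (frob_inner Q : 'M[R]_(p, q) -> R).
  exact: linear_mx_continuous.
pose F Z := fine (fenchel f Z).
pose c := ((p * q)%:R * C) ^+ 2 / (2 * mu).
have c0 : 0 <= c by rewrite divr_ge0 ?sqr_ge0// mulr_ge0// ltW.
have remainder H : `|F (H + Z) - F Z - frob_inner Q H| <= c * `|H| ^+ 2.
  have [Q' Q'Z] := subdiff_surjective (H + Z) QZ; have [domQ' _] := Q'Z.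
  rewrite /F (fenchel_subdiff QZ) (fenchel_subdiff Q'Z).
  have := subdiff_minorant Q'Z domQ.
  have := subdiff_quadratic_minorant QZ domQ'.
  have := le_trans (ler_norm _) (frob_inner_le_normr H (Q' - Q)).
  rewrite (frob_innerC Q H) (frob_innerC (H + Z) (Q - Q')).
  rewrite (frob_innerC (H + Z) Q') !linearD !linearN /=.
  rewrite !(frob_innerC (Q - Q')) !(frob_innerC Q') !linearD !linearN /=.
  set nu := N (Q' - Q) => h1 h2 h3.
  have h4 : (p * q)%:R * `|H| * `|Q' - Q| <= (p * q)%:R * C * `|H| * nu.
    rewrite -mulrA -[leRHS]mulrA -[leRHS]mulrA ler_wpM2l// mulrCA ler_wpM2l//.
  have h5 : (p * q)%:R * C * `|H| * nu - mu / 2 * nu ^+ 2 <= c * `|H| ^+ 2.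
    rewrite -subr_ge0 /c; set b := _ * C; set n := `|H|.
    (* complete the square in nu *)
    have -> : b ^+ 2 / (2 * mu) * n ^+ 2 - (b * n * nu - mu / 2 * nu ^+ 2) =
        (b * n - mu * nu) ^+ 2 / (2 * mu).
      by field; rewrite gt_eqF.
    by rewrite divr_ge0 ?sqr_ge0// mulr_ge0// ltW.
  by rewrite ger0_norm; lra.
have dF : 'd F Z = frob_inner Q :> ('M[R]_(p, q) -> R).
  apply: diff_unique => //; apply/eqaddoP => e e0.
  have c1 : 0 < c + 1 by rewrite ltr_wpDl.
  near=> H.
  rewrite /= !fctE /= /cst opprD addrA; apply: le_trans (remainder H) _.
  rewrite expr2 mulrA ler_wpM2r//.
  apply: le_trans (_ : (c + 1) * `|H| <= _); first by rewrite ler_wpM2r// lerDl.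
  rewrite mulrC -ler_pdivlMr//; near: H.
  by apply: (@nbhs0_le R 'M[R]_(p, q)); rewrite divr_gt0.
by apply/matrixP => i j; rewrite mxE dF frob_inner_delta.
Unshelve. all: by end_near. Qed.

End MirrorMap.

(** * Contracting gauges of Schur stable maps *)

(** For d small enough, rho + d is still a contraction factor, and the constant
    input d C moves the fixed point by less than any given e; the two choices
    are made for the midpoint r of rho and 1. *)
Lemma perturbed_contraction_cvg0 (R : realType) (a : nat -> R) (rho C : R) :
  0 <= rho < 1 -> 0 <= C -> (forall n, 0 <= a n) ->
  (forall d, 0 < d -> \forall n \near \oo, a n.+1 <= rho * a n + d * (C + a n)) ->
  a @ \oo --> (0 : R).
Proof.
move=> /andP[rho0 rho1] C0 a0 acontr; apply/cvgr0Pnorm_le => e e0.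
pose r := (1 + rho) / 2.
have r0 : 0 <= r by rewrite /r; lra.
have r1 : r < 1 by rewrite /r; lra.
pose d := Num.min ((1 - rho) / 2) ((1 - r) * (e / 2) / (C + 1)).
have C1 : 0 < C + 1 by rewrite ltr_wpDl.
have d0 : 0 < d.
  rewrite lt_min; apply/andP; split; first by lra.
  by rewrite divr_gt0// mulr_gt0 ?divr_gt0// subr_gt0.
have dr : rho + d <= r.
  have : d <= (1 - rho) / 2 by rewrite ge_min lexx.
  by rewrite /r; lra.
have dC : d * C <= (1 - r) * (e / 2).
  have : d * (C + 1) <= (1 - r) * (e / 2).
    by rewrite -ler_pdivlMr// ge_min lexx orbT.
  by have := ltW d0; lra.
have [T _ aT] := acontr d d0.
have bound n : a (T + n)%N <= e / 2 + r ^+ n * a T.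
  elim: n => [|n IHn]; first by rewrite addn0 expr0 mul1r; lra.
  rewrite addnS exprS; apply: le_trans (aT _ (leq_addr _ _)) _.
  have := ler_wpM2r (a0 (T + n)%N) dr; have := ler_wpM2l r0 IHn.
  by lra.
have e20 : 0 < e / 2 by rewrite divr_gt0.
have /cvgr0Pnorm_le/(_ (e / 2) e20)[S _ rS] : (fun n => r ^+ n * a T) @ \oo --> (0 : R).
  rewrite -[X in _ --> X](mul0r (a T)); apply: cvgM; last exact: cvg_cst.
  by apply: cvg_expr; rewrite ger0_norm.
exists (T + S)%N => // n /= TSn.
have Tn : (T <= n)%N by exact: leq_trans (leq_addr _ _) TSn.
rewrite ger0_norm// -(subnKC Tn); apply: le_trans (bound _) _.
have := rS (n - T)%N; rewrite /= -(leq_add2l T) subnKC// => /(_ TSn).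
by have := ler_norm (r ^+ (n - T) * a T); lra.
Qed.

Section ComplexPowers.
Variables (R : realType) (n : nat).
Local Notation normc := ComplexField.Normc.normc.

Definition l1normc (v : 'rV[R[i]]_n) : R := \sum_j normc (v 0 j).

Lemma normc_ge0 (z : R[i]) : 0 <= normc z.
Proof. by case: z => x y; exact: sqrtr_ge0. Qed.

Lemma l1normc_ge0 v : 0 <= l1normc v.
Proof. by apply: sumr_ge0 => j _; exact: normc_ge0. Qed.

Lemma l1normcD u v : l1normc (u + v) <= l1normc u + l1normc v.
Proof.
rewrite -big_split /=; apply: ler_sum => j _; rewrite mxE.
exact: (@le_normcD R (u 0 j) (v 0 j)).
Qed.

Lemma l1normcZ z v : l1normc (z *: v) = normc z * l1normc v.
Proof.
rewrite mulr_sumr; apply: eq_bigr => j _; rewrite mxE.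
exact: ComplexField.Normc.normcM.
Qed.

End ComplexPowers.

(** Induction on the roots: for w = v (M - z), the orbits u_j of v and w_j of w
    satisfy u_{j+1} = z u_j + w_j, where w_j tends to 0 because w is annihilated
    by the remaining factors. *)
Lemma annihilated_orbit_cvg0 (R : realType) (n : nat) (M : 'M[R[i]]_n.+1)
    (s : seq R[i]) (v : 'rV[R[i]]_n.+1) :
  (forall z, z \in s -> ComplexField.Normc.normc z < 1) ->
  v *m horner_mx M (\prod_(z <- s) ('X - z%:P)) = 0 ->
  (fun j => l1normc (v *m M ^+ j)) @ \oo --> (0 : R).
Proof.
elim: s v => [|z s IHs] v s1.
  rewrite big_nil rmorph1 mulmx1 => ->.
  rewrite (_ : (fun j => _) = cst 0); first exact: cvg_cst.
  apply/funext => j; rewrite mul0mx /l1normc big1// => i _.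
  by rewrite mxE ComplexField.Normc.normc0.
rewrite big_cons rmorphM /= rmorphB /= horner_mx_X horner_mx_C.
rewrite -[X in v *m X]/(_ *m _) mulmxA => v0.
have {}IHs := IHs _ (fun y ys => s1 y (mem_behead (s := z :: s) ys)) v0.
apply: (@perturbed_contraction_cvg0 _ _ (ComplexField.Normc.normc z) 1) => //.
- by rewrite normc_ge0 s1// mem_head.
- by move=> j; exact: l1normc_ge0.
move=> d d0; move/cvgr0Pnorm_le/(_ d d0): IHs; apply: filterS => j.
rewrite ger0_norm ?l1normc_ge0// => wd.
have -> : v *m M ^+ j.+1 = z *: (v *m M ^+ j) + v *m (M - z%:M) *m M ^+ j.
  rewrite mulmxBr mulmxBl mul_mx_scalar -scalemxAl addrC subrK.
  by rewrite exprS -[_ * _]/(_ *m _) mulmxA.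
apply: le_trans (l1normcD _ _) _; rewrite l1normcZ lerD2l.
apply: le_trans wd _; have := l1normc_ge0 (v *m M ^+ j).
by nra.
Qed.

(** The moduli of the eigenvalues are bounded, being those of the roots of the
    characteristic polynomial, so the spectral radius is an upper bound. *)
Lemma schur_stable_eigenvalue (R : realType) (p q : nat)
    (L : 'M[R]_(p, q) -> 'M[R]_(p, q)) z :
  schur_stable L -> eigenvalue (map_mx (real_complex R) (lin_mx L)) z ->
  ComplexField.Normc.normc z < 1.
Proof.
move=> L1 ez; apply: le_lt_trans L1; apply: ub_le_sup; last by exists z.
have [rs rsE] := closed_field_poly_normal
  (char_poly (map_mx (real_complex R) (lin_mx L))).
rewrite (monicP (char_poly_monic _)) scale1r in rsE.
exists (\sum_(y <- rs) ComplexField.Normc.normc y) => r [y].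
rewrite eigenvalue_root_char rsE root_prod_XsubC => yrs <-.
rewrite (big_rem y)//= lerDl; apply: sumr_ge0 => x _; exact: normc_ge0.
Qed.

Lemma orbit_cvg0 (R : realType) (n : nat) (M : 'M[R[i]]_n) (v : 'rV[R[i]]_n) :
  (forall z, eigenvalue M z -> ComplexField.Normc.normc z < 1) ->
  (fun j => l1normc (v *m M ^+ j)) @ \oo --> (0 : R).
Proof.
case: n M v => [M v _|n M v M1].
  rewrite (_ : (fun j => _) = cst 0); first exact: cvg_cst.
  by apply/funext => j; rewrite /l1normc big_ord0.
have [rs rsE] := closed_field_poly_normal (char_poly M).
rewrite (monicP (char_poly_monic _)) scale1r in rsE.
apply: (@annihilated_orbit_cvg0 _ _ M rs) => [z zrs|].
  by apply: M1; rewrite eigenvalue_root_char rsE root_prod_XsubC.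
by rewrite -rsE Cayley_Hamilton mulmx0.
Qed.

Lemma schur_stable_orbit_cvg0 (R : realType) (p q : nat)
    (L : {linear 'M[R]_(p, q) -> 'M[R]_(p, q)}) X :
  schur_stable L -> (fun j => `|iter j L X|) @ \oo --> (0 : R).
Proof.
move=> L1; set M := map_mx (real_complex R) (lin_mx L).
have M1 z : eigenvalue M z -> ComplexField.Normc.normc z < 1.
  exact: schur_stable_eigenvalue.
have orbitE j : map_mx (real_complex R) (mxvec (iter j L X)) =
    map_mx (real_complex R) (mxvec X) *m M ^+ j.
  elim: j => [|j IHj]; first by rewrite expr0 mulmx1.
  by rewrite iterS -mul_vec_lin map_mxM IHj exprSr -mulmxA.
apply: (squeeze_cvgr _ (cvg_cst _) (orbit_cvg0 (map_mx (real_complex R) (mxvec X)) M1)).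
apply: nearW => j; rewrite normr_ge0 /= -orbitE.
apply: normr_mx_le => [|a b]; first exact: l1normc_ge0.
rewrite /l1normc (bigD1 (mxvec_index a b))//= mxE mxvecE /= expr0n addr0.
rewrite sqrtr_sqr lerDl; apply: sumr_ge0 => c _; exact: normc_ge0.
Qed.

Lemma schur_stable_half_contraction (R : realType) (p q : nat)
    (L : {linear 'M[R]_(p, q) -> 'M[R]_(p, q)}) :
  schur_stable L -> exists r, forall X, `|iter r.+1 L X| <= 2^-1 * `|X|.
Proof.
move=> L1; pose c : R := (2 * (p * q).+1%:R)^-1.
have c0 : 0 < c by rewrite invr_gt0 mulr_gt0.
have [r _ rP] : \forall r \near \oo, forall i j,
    `|iter r L (delta_mx i j)| <= c.
  apply: filter_forall => i; apply: filter_forall => j.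
  have /cvgr0Pnorm_le/(_ c c0) := schur_stable_orbit_cvg0 (delta_mx i j) L1.
  by apply: filterS => r; rewrite normr_id.
exists r => X; have {}rP := rP r.+1 (leqnSn r).
have iterZD a Y Z : iter r.+1 L (a *: Y + Z) = a *: iter r.+1 L Y + iter r.+1 L Z.
  by elim: (r.+1) => //= l ->; rewrite linearP.
pose Lr := GRing.isLinear.Build R 'M[R]_(p, q) 'M[R]_(p, q) _ (iter r.+1 L) iterZD.
pose Lr' : {linear _ -> _} := HB.pack (iter r.+1 L) Lr.
rewrite -[iter r.+1 L X]/(Lr' X) {1}(matrix_sum_delta X) linear_sum.
apply: le_trans (ler_norm_sum _ _ _) _.
apply: le_trans (_ : \sum_(i < p) \sum_(j < q) (c * `|X|) <= _).
  apply: ler_sum => i _; rewrite linear_sum.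
  apply: le_trans (ler_norm_sum _ _ _) _; apply: ler_sum => j _.
  rewrite linearZ normrZ mulrC ler_pM// ?normr_entry_le//.
  exact: rP.
rewrite !sumr_const !card_ord -mulrnA -[leLHS]mulr_natl mulrA ler_wpM2r//.
rewrite /c invfM mulrCA ler_piMr// ?invr_ge0// ler_pdivrMr// mul1r ler_nat.
by rewrite mulnC ltnW.
Qed.

(** V X = |X| + |L X| + ... + |L^r X|, where L^{r+1} halves the norm, telescopes
    to V (L X) <= V X - |X| / 2, and |X| is at least V X / D. *)
Lemma schur_stable_contracting_gauge (R : realType) (p q : nat)
    (L : {linear 'M[R]_(p, q) -> 'M[R]_(p, q)}) :
  schur_stable L -> exists (V : 'M[R]_(p, q) -> R) (rho C : R),
  [/\ 0 <= rho < 1, 0 <= C,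
      forall X Y, V (X + Y) <= V X + V Y,
      forall X, `|X| <= V X <= C * `|X| &
      forall X, V (L X) <= rho * V X].
Proof.
move=> /schur_stable_half_contraction[r Lr].
have [C C0 LC] := linear_mx_bounded L.
pose V X := \sum_(i < r.+1) `|iter i L X|.
pose D := \sum_(i < r.+1) C ^+ i.
have iterC i X : `|iter i L X| <= C ^+ i * `|X|.
  elim: i => [|i IHi]; first by rewrite expr0 mul1r.
  by rewrite iterS exprS -mulrA; apply: le_trans (LC _) _; rewrite ler_wpM2l.
have D1 : 1 <= D.
  by rewrite /D big_ord_recl expr0 lerDl sumr_ge0// => i _; exact: exprn_ge0.
have VD X : V X <= D * `|X|.
  by rewrite mulr_suml; apply: ler_sum => i _; exact: iterC.
exists V, (1 - (2 * D)^-1), D; split.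
- rewrite subr_ge0 invf_le1 ?ltrBlDr ?ltrDl ?invr_gt0; lra.
- by lra.
- move=> X Y; rewrite -big_split /=; apply: ler_sum => i _.
  have -> : iter i L (X + Y) = iter i L X + iter i L Y.
    by elim: (val i) => //= j ->; rewrite linearD.
  exact: ler_normD.
- by move=> X; rewrite VD andbT /V big_ord_recl lerDl sumr_ge0.
move=> X.
have VL : V (L X) = V X - `|X| + `|iter r.+1 L X|.
  rewrite /V big_ord_recr [in RHS]big_ord_recl /= -iterSr.
  under eq_bigr do rewrite -iterSr.
  by rewrite [in RHS](addrC `|X|) addrK.
have D_gt0 : 0 < D by lra.
have : V X / (2 * D) <= `|X| / 2.
  rewrite ler_pdivrMr ?mulr_gt0//.
  by have -> : `|X| / 2 * (2 * D) = D * `|X| by field.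
by have := Lr X; rewrite VL mulrBl mul1r (mulrC (2 * D)^-1) /=; lra.
Qed.

(** * The loss and its gradient *)

Lemma frob_norm_ge0 (R : realType) (p q : nat) (X : 'M[R]_(p, q)) :
  0 <= frob_norm X.
Proof. exact: sqrtr_ge0. Qed.

Lemma normr_le_frob_norm (R : realType) (p q : nat) (X : 'M[R]_(p, q)) :
  `|X| <= frob_norm X.
Proof.
apply: normr_mx_le => [|i j]; first exact: frob_norm_ge0.
rewrite -sqrtr_sqr ler_wsqrtr// frob_innerE (bigD1 i)//= (bigD1 j)//=.
rewrite -expr2 -addrA lerDl addr_ge0// sumr_ge0// => a _.
  by rewrite -expr2 sqr_ge0.
by rewrite sumr_ge0// => b _; rewrite -expr2 sqr_ge0.
Qed.

Lemma frob_norm_le_normr (R : realType) (p q : nat) (X : 'M[R]_(p, q)) :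
  frob_norm X <= Num.sqrt (p * q)%:R * `|X|.
Proof.
rewrite -[X in _ * X]normr_id -[X in _ * X]sqrtr_sqr -sqrtrM// ler_wsqrtr//.
apply: le_trans (ler_norm _) _; apply: le_trans (frob_inner_le_normr _ _) _.
by rewrite -mulrA.
Qed.

Lemma normr_mulmx_le (R : realType) (p q r : nat) (X : 'M[R]_(p, q))
    (Y : 'M[R]_(q, r)) : `|X *m Y| <= q%:R * `|X| * `|Y|.
Proof.
apply: normr_mx_le => [|i j]; first by rewrite !mulr_ge0.
rewrite mxE; apply: le_trans (ler_norm_sum _ _ _) _.
apply: le_trans (_ : \sum_(l < q) `|X| * `|Y| <= _); last first.
  by rewrite sumr_const card_ord -[leLHS]mulr_natl mulrA.
by apply: ler_sum => l _; rewrite normrM ler_pM// normr_entry_le.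
Qed.

Section LossGradient.
Variables (R : realType) (n1 n2 m k : nat).
Variable B : {linear 'M[R]_(m, n2) -> 'M[R]_(n1, n2)}.

Lemma adjoint_exists : exists Bt : 'M[R]_(n1, n2) -> 'M[R]_(m, n2),
  forall U V, frob_inner (B U) V = frob_inner U (Bt V).
Proof.
exists (fun V => \matrix_(i, j) frob_inner V (B (delta_mx i j))) => U V.
rewrite frob_innerC {1}(matrix_sum_delta U) !linear_sum frob_innerE.
apply: eq_bigr => i _; rewrite !linear_sum; apply: eq_bigr => j _.
by rewrite !linearZ /= mxE.
Qed.

Lemma frob_inner_grad_loss Theta (W : 'M[R]_(k, n2)) P H :
  frob_inner (grad (loss B Theta W) P) H =
  - frob_inner (B ((Theta - P) *m W)) (B (H *m W)).
Proof.
have [Bt BtE] := adjoint_exists.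
rewrite (grad_loss _ _ _ BtE) frob_innerC linearN /=; congr (- _).
rewrite [RHS]frob_innerC BtE /frob_inner trmx_mul.
by rewrite mulmxA mxtrace_mulC mulmxA.
Qed.

(** One factor of the residual is kept: the gradient is small when the
    residual is, which a bound by |W|^2 alone would lose. *)
Lemma dual_norm_grad_loss_le (N : 'M[R]_(m, k) -> R) : is_norm N ->
  exists2 C, 0 <= C & forall Theta (W : 'M[R]_(k, n2)) P,
    dual_norm N (grad (loss B Theta W) P) <=
    C * frob_norm (B ((Theta - P) *m W)) * `|W|.
Proof.
move=> Nn; have [CN CN0 NC] := normr_le_norm_mx Nn.
have [CB CB0 BC] := linear_mx_bounded B.
exists ((n1 * n2)%:R * CB * k%:R * CN); first by rewrite !mulr_ge0.
move=> Theta W P; apply: dual_norm_le => // H H1.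
rewrite frob_inner_grad_loss; set E := B (_ *m W).
apply: le_trans (ler_norm _) _; rewrite normrN.
apply: le_trans (frob_inner_le_normr _ _) _.
have HC : `|H| <= CN by apply: le_trans (NC H) _; rewrite ler_piMr.
have BH : `|B (H *m W)| <= CB * (k%:R * CN * `|W|).
  apply: le_trans (BC _) _; apply: ler_wpM2l => //.
  by apply: le_trans (normr_mulmx_le _ _) _; rewrite ler_wpM2r// ler_wpM2l.
apply: le_trans (_ : (n1 * n2)%:R * frob_norm E * (CB * (k%:R * CN * `|W|)) <= _).
  apply: ler_pM; rewrite ?mulr_ge0//.
  by rewrite ler_wpM2l// normr_le_frob_norm.
by rewrite le_eqVlt; apply/orP; left; apply/eqP; ring.
Qed.

End LossGradient.

(** * Decrease of the Bregman divergence *)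

Section MirrorDescentStep.
Variables (R : realType) (p q : nat) (N : 'M[R]_(p, q) -> R) (mu : R).
Variable f : 'M[R]_(p, q) -> \bar R.
Hypotheses (N_norm : is_norm N) (mu_gt0 : 0 < mu).
Hypotheses (f_proper : eproper f) (f_sconvex : strongly_convex N mu f).

(** Since f need not be differentiable, the divergence depends on the choice of
    the subgradient Z of f at P. *)
Definition bregman (T P Z : 'M[R]_(p, q)) : R :=
  fine (f T) - fine (f P) - frob_inner Z (T - P).

Lemma bregman_ge T P Z : edom f T -> subdiff f P Z ->
  mu / 2 * N (T - P) ^+ 2 <= bregman T P Z.
Proof.
move=> domT PZ; rewrite /bregman.
by have := subdiff_quadratic_minorant f_proper f_sconvex PZ domT; lra.
Qed.

(** Strong convexity at P bounds the decrement below by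
    eta <G, P - T> - eta g n + mu/2 n^2, where g is the dual norm of G and n the
    norm of P' - P.  The first term is 2 eta J, and minimising over n costs
    eta^2 g^2 / (2 mu), which by the choice of eta is at most eta J. *)
Lemma mirror_descent_step T P Z P' Z' G e J (eta := step_size N mu e J G) :
  subdiff f P Z -> subdiff f P' Z' -> Z' = Z - eta *: G ->
  0 <= e -> 0 <= J -> frob_inner G (P - T) = 2 * J ->
  0 <= bregman T P Z - bregman T P' Z' /\
  2 * mu * J ^+ 2 <=
    (bregman T P Z - bregman T P' Z') * (e + dual_norm N G ^+ 2).
Proof.
move=> PZ P'Z' Z'E e0 J0 GE; have [domP' _] := P'Z'.
set dD := _ - bregman _ _ _; pose g := dual_norm N G.
have g0 : 0 <= g by exact: dual_norm_ge0.
have den0 : 0 <= e + g ^+ 2 by rewrite addr_ge0 ?sqr_ge0.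
have eta0 : 0 <= eta.
  by rewrite /eta /step_size divr_ge0// !mulr_ge0// ltW.
have etaE : eta * (e + g ^+ 2) = 2 * mu * J.
  rewrite /eta /step_size -/g.
  (* a zero denominator forces g = 0, hence J = 0: eta = 0 is then consistent *)
  have [den|den] := eqVneq (e + g ^+ 2) 0; last by rewrite divfK.
  have g2 : g ^+ 2 = 0 by have := sqr_ge0 g; lra.
  have gz : g = 0 by apply/eqP; rewrite -sqrf_eq0 g2.
  have : frob_inner G (P - T) <= 0.
    by apply: le_trans (frob_inner_le_dual_norm N_norm _ _) _; rewrite -/g gz mul0r.
  rewrite GE den mulr0 => J2.
  by rewrite (_ : J = 0) ?mulr0//; lra.
have descent : eta * J <= dD.
  have := subdiff_quadratic_minorant f_proper f_sconvex PZ domP'.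
  have := ler_wpM2l eta0 (frob_inner_le_dual_norm N_norm G (P - P')).
  have -> : N (P - P') = N (P' - P).
    by have [_ NZ _] := N_norm; rewrite -opprB -scaleN1r NZ normrN1 mul1r.
  move: GE; rewrite -/g /dD /bregman Z'E !frob_innerBl !frob_innerZl.
  rewrite !linearB /=; set nu := N _ => h1 h2 h3.
  have h4 : eta * (g * nu) - mu / 2 * nu ^+ 2 <= eta * J.
    have : 0 <= (eta * g - mu * nu) ^+ 2 / (2 * mu).
      by rewrite divr_ge0 ?sqr_ge0// mulr_ge0// ltW.
    have -> : (eta * g - mu * nu) ^+ 2 / (2 * mu) =
        eta ^+ 2 * g ^+ 2 / (2 * mu) - (eta * (g * nu) - mu / 2 * nu ^+ 2).
      by field; rewrite gt_eqF.
    have : eta ^+ 2 * g ^+ 2 / (2 * mu) <= eta * J.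
      rewrite ler_pdivrMr ?mulr_gt0//.
      have -> : eta * J * (2 * mu) = eta ^+ 2 * g ^+ 2 + eta ^+ 2 * e.
        have -> : eta * J * (2 * mu) = eta * (eta * (e + g ^+ 2)).
          by rewrite etaE; ring.
        by ring.
      by rewrite lerDl mulr_ge0 ?sqr_ge0.
    by lra.
  have h5 : eta * frob_inner G P - eta * frob_inner G T = 2 * (eta * J).
    by rewrite -mulrBr h1; ring.
  by lra.
split; first by apply: le_trans descent; rewrite mulr_ge0.
apply: le_trans (ler_wpM2r den0 descent); rewrite -/g.
by rewrite [leRHS]mulrAC etaE expr2 mulrA.
Qed.

End MirrorDescentStep.

(** If r > delta y, then r^4 exceeds both delta^4 and delta^2 r^2 y^2, so each of
    the two terms on the right of the hypothesis is less than mu/4 r^4. *)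
Lemma small_relative_residual (R : realType) (mu d r y C1 C2 delta : R) :
  0 < mu -> 0 <= d -> 0 < delta -> 0 <= r -> 1 <= y ->
  mu / 2 * r ^+ 4 <= d * (C1 + C2 * r ^+ 2 * y ^+ 2) ->
  d * C1 <= mu / 4 * delta ^+ 4 -> d * C2 <= mu / 4 * delta ^+ 2 ->
  r <= delta * y.
Proof.
move=> mu0 d0 delta0 r0 y1 hr h1 h2; rewrite leNgt; apply/negP => ry.
have dy0 : 0 < delta * y by rewrite mulr_gt0//; lra.
have rd : delta <= r.
  by apply: le_trans (ltW ry); rewrite ler_peMr// ltW.
have r_gt0 : 0 < r by lra.
have r4 : delta ^+ 4 <= r ^+ 4 by rewrite lerXn2r ?nnegrE ?(ltW delta0).
have r2 : (delta * y) ^+ 2 < r ^+ 2 by rewrite ltrXn2r ?nnegrE ?(ltW dy0).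
have h3 : d * C2 * (r ^+ 2 * y ^+ 2) <= mu / 4 * delta ^+ 2 * (r ^+ 2 * y ^+ 2).
  by rewrite ler_wpM2r// mulr_ge0 ?sqr_ge0.
have h4 : mu / 4 * delta ^+ 2 * (r ^+ 2 * y ^+ 2) < mu / 4 * r ^+ 4.
  have -> : mu / 4 * delta ^+ 2 * (r ^+ 2 * y ^+ 2) =
      mu / 4 * r ^+ 2 * (delta * y) ^+ 2 by ring.
  have -> : mu / 4 * r ^+ 4 = mu / 4 * r ^+ 2 * r ^+ 2 by ring.
  by rewrite ltr_pM2l// mulr_gt0 ?divr_gt0// exprn_gt0.
have h5 : mu / 4 * delta ^+ 4 <= mu / 4 * r ^+ 4.
  by rewrite ler_wpM2l// divr_ge0// ltW.
by move: hr; rewrite mulrDr -!mulrA mulrA; lra.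
Qed.

Lemma nonincreasing_decrements_cvg0 (R : realType) (D : nat -> R) :
  (forall t, 0 <= D t) -> (forall t, 0 <= D t - D t.+1) ->
  (fun t => D t - D t.+1) @ \oo --> (0 : R).
Proof.
move=> D0 dD; have cD : cvgn D.
  apply: nonincreasing_is_cvgn; last by exists 0 => _ [t _ <-].
  by apply/nonincreasing_seqP => t; have := dD t; rewrite subr_ge0.
rewrite -[X in _ --> X](subrr (limn D)); apply: cvgB => //.
by rewrite (cvg_shiftS D).
Qed.

(** * The closed loop *)

Section StableRecursion.
Variables (R : realType) (p q : nat).
Variable L : {linear 'M[R]_(p, q) -> 'M[R]_(p, q)}.
Hypothesis L_stable : schur_stable L.

Lemma stable_recursion_bounded (Y u : nat -> 'M[R]_(p, q)) (c : R) :
  (forall t, Y t.+1 = L (Y t) + u t) -> (forall t, `|u t| <= c) ->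
  exists2 C, 0 <= C & forall t, `|Y t| <= C.
Proof.
move=> YE uc; have [V [rho [C [/andP[rho0 rho1] C0 VD VC VL]]]] :=
  schur_stable_contracting_gauge L_stable.
have V0 X : 0 <= V X by have /andP[+ _] := VC X; apply: le_trans.
have c0 : 0 <= c by exact: le_trans (uc 0%N).
have rho1' : 0 < 1 - rho by rewrite subr_gt0.
pose M := V (Y 0%N) + C * c / (1 - rho).
have M0 : 0 <= M by rewrite addr_ge0// divr_ge0 ?(ltW rho1')// mulr_ge0.
exists M => // t; have /andP[+ _] := VC (Y t).
move=> /le_trans; apply; elim: t => [|t IHt].
  by rewrite lerDl divr_ge0 ?(ltW rho1')// mulr_ge0.
rewrite YE; apply: le_trans (VD _ _) _.
have Vu : V (u t) <= C * c.
  by have /andP[_] := VC (u t); move/le_trans; apply; rewrite ler_wpM2l.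
have rhoM : rho * M + C * c <= M.
  rewrite -subr_ge0; have -> : M - (rho * M + C * c) = (1 - rho) * V (Y 0%N).
    by rewrite /M; field; rewrite gt_eqF.
  by rewrite mulr_ge0// ltW.
have := VL (Y t); have := ler_wpM2l rho0 IHt; lra.
Qed.

(** Small gain: the disturbance may grow with the state, provided that its
    share of it vanishes asymptotically. *)
Lemma stable_recursion_cvg0 (Y w : nat -> 'M[R]_(p, q)) (c : R) :
  (forall t, Y t.+1 = L (Y t) + w t) -> 0 <= c ->
  (forall d, 0 < d -> \forall t \near \oo, `|w t| <= d * (c + `|Y t|)) ->
  (fun t => `|Y t|) @ \oo --> (0 : R).
Proof.
move=> YE c0 wY; have [V [rho [C [rho01 C0 VD VC VL]]]] :=
  schur_stable_contracting_gauge L_stable.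
have VY t : `|Y t| <= V (Y t) by have /andP[] := VC (Y t).
suff V_cvg0 : (V \o Y) @ \oo --> (0 : R).
  apply: (squeeze_cvgr _ (cvg_cst _) V_cvg0).
  by apply: nearW => t; rewrite normr_ge0 VY.
apply: (perturbed_contraction_cvg0 rho01 c0) => [t|d d0] /=.
  exact: le_trans (VY t).
have C1 : 0 < C + 1 by rewrite ltr_wpDl.
have := wY (d / (C + 1)) (divr_gt0 d0 C1); apply: filterS => t wt.
rewrite YE; apply: le_trans (VD _ _) _; apply: lerD; first exact: VL.
have /andP[_ Vw] := VC (w t); apply: le_trans Vw _.
apply: le_trans (_ : (C + 1) * (d / (C + 1) * (c + V (Y t))) <= _).
  apply: ler_pM => //; first by rewrite lerDl.
  by apply: le_trans wt _; rewrite ler_wpM2l ?lerD2l// divr_ge0// ltW.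
by rewrite mulrA mulrCA divff ?mulr1// gt_eqF.
Qed.

End StableRecursion.

Theorem theorem1 (R : realType) (n1 n2 m k : nat)
  (n1_gt0 : (0 < n1)%N) (n2_gt0 : (0 < n2)%N)
  (m_gt0 : (0 < m)%N) (k_gt0 : (0 < k)%N)
  (A : {linear 'M[R]_(n1, n2) -> 'M[R]_(n1, n2)})
  (B : {linear 'M[R]_(m, n2) -> 'M[R]_(n1, n2)})
  (K : {linear 'M[R]_(n1, n2) -> 'M[R]_(m, n2)})
  (stable_ABK : schur_stable (fun X => A X - B (K X)))
  (Psi : 'M[R]_(n1, n2) -> nat -> 'M[R]_(k, n2))
  (Ud : nat -> 'M[R]_(m, n2))
  (Ud_bounded : exists C : R, forall t, frob_norm (Ud t) <= C)
  (Omega : set 'M[R]_(m, k)) (Theta : 'M[R]_(m, k)) (Omega_Theta : Omega Theta)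
  (N : 'M[R]_(m, k) -> R) (N_norm : is_norm N)
  (f : 'M[R]_(m, k) -> \bar R) (mu : R) (mu_gt0 : 0 < mu)
  (f_proper : eproper f) (f_lsc : lower_semicontinuous f) (f_convex : econvex f)
  (Omega_dom : Omega `<=` edom f)
  (f_sconvex : strongly_convex N mu f)
  (eps : nat -> R)
  (eps_ge0 : forall t, 0 <= eps t.+1)
  (eps_bounded : exists C : R, forall t, eps t.+1 <= C)
  (X : nat -> 'M[R]_(n1, n2)) (U : nat -> 'M[R]_(m, n2))
  (hTheta Z : nat -> 'M[R]_(m, k)) (eta : nat -> R)
  (X_rec : forall t, X t.+1 = A (X t) + B (Theta *m Psi (X t) t + U t))
  (U_def : forall t, U t = - K (X t) - hTheta t *m Psi (X t) t + Ud t)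
  (Z0_subdiff : subdiff f (hTheta 0%N) (Z 0%N))
  (Z_rec : forall t, Z t.+1 =
     Z t - eta t.+1 *: grad (loss B Theta (Psi (X t) t)) (hTheta t))
  (hTheta_rec : forall t, hTheta t.+1 = mirror_map f (Z t.+1))
  (eta_def : forall t, eta t.+1 =
     step_size N mu (eps t.+1) (loss B Theta (Psi (X t) t) (hTheta t))
       (grad (loss B Theta (Psi (X t) t)) (hTheta t)))
  (Xd : nat -> 'M[R]_(n1, n2))
  (Xd_rec : forall t, Xd t.+1 = (A (Xd t) - B (K (Xd t))) + B (Ud t))
  (c1 c2 : R) (c1_ge0 : 0 <= c1) (c2_ge0 : 0 <= c2)
  (Psi_growth : forall Y t, frob_norm (Psi Y t) <= c1 + c2 * frob_norm Y) :
  [/\ exists C : R, forall t, frob_norm (X t) <= C,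
      exists C : R, forall t, frob_norm (hTheta t) <= C &
      (fun t => frob_norm (X t - Xd t)) @ \oo --> (0 : R)].
Proof.
have [Ce epsC] := eps_bounded; have [Cu UdC] := Ud_bounded.
have Ce0 : 0 <= Ce := le_trans (eps_ge0 0%N) (epsC 0%N).
have domTheta : edom f Theta by exact: Omega_dom.
have [CN CN0 NC] := normr_le_norm_mx N_norm.
have [CB CB0 BC] := linear_mx_bounded B.
have [CG CG0 GC] := dual_norm_grad_loss_le B N_norm.
pose L : {linear 'M[R]_(n1, n2) -> 'M[R]_(n1, n2)} := A \- (B \o K).
have L_stable : schur_stable L by exact: stable_ABK.
have thetaZ t : subdiff f (hTheta t) (Z t).
  case: t => [//|t]; rewrite hTheta_rec.
  have [Q QZ] := subdiff_surjective N_norm mu_gt0 f_proper f_lsc f_sconvex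
    (Z t.+1) Z0_subdiff.
  by rewrite (mirror_map_subdiff N_norm mu_gt0 f_proper f_lsc f_sconvex QZ).
pose W t := Psi (X t) t.
pose w t := B ((Theta - hTheta t) *m W t).
pose r t := frob_norm (w t).
pose G t := grad (loss B Theta (W t)) (hTheta t).
pose D t := bregman f Theta (hTheta t) (Z t).
have D_ge t : mu / 2 * N (Theta - hTheta t) ^+ 2 <= D t.
  exact: bregman_ge.
have D0 t : 0 <= D t.
  by apply: le_trans (D_ge t); rewrite mulr_ge0 ?sqr_ge0// divr_ge0// ltW.
have step t : 0 <= D t - D t.+1 /\
    2 * mu * (1 / 2 * r t ^+ 2) ^+ 2 <=
      (D t - D t.+1) * (eps t.+1 + dual_norm N (G t) ^+ 2).
  apply: (mirror_descent_step N_norm mu_gt0 f_proper f_sconvex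
    (thetaZ t) (thetaZ t.+1)) => //.
  - by rewrite Z_rec eta_def.
  - by rewrite mulr_ge0 ?sqr_ge0// divr_ge0.
  rewrite frob_inner_grad_loss -(opprB Theta) mulNmx linearN linearN /= opprK.
  by rewrite /r frob_norm_sqr; field.
have D_mono t : D t <= D 0%N.
  by elim: t => // t IHt; have [] := step t; lra.
have d_cvg0 : (fun t => D t - D t.+1) @ \oo --> (0 : R).
  by apply: nonincreasing_decrements_cvg0 => // t; have [] := step t.
have hTheta_bounded : exists C : R, forall t, frob_norm (hTheta t) <= C.
  (* nu <= 1 + nu^2 spares a square root *)
  pose S := 1 + 2 * D 0%N / mu.
  exists (Num.sqrt (m * k)%:R * (`|Theta| + CN * S)) => t.
  apply: le_trans (frob_norm_le_normr _) _; rewrite ler_wpM2l ?sqrtr_ge0//.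
  have := ler_normB Theta (Theta - hTheta t); rewrite opprB addrC subrK.
  move=> /le_trans; apply; rewrite lerD2l; apply: le_trans (NC _) _.
  rewrite ler_wpM2l//; set nu := N _.
  have nu2 : nu ^+ 2 <= 2 * D 0%N / mu.
    rewrite ler_pdivlMr//.
    by have := le_trans (D_ge t) (D_mono t); rewrite -/nu; lra.
  by rewrite /S; have := sqr_ge0 (nu - 1); nra.
pose s : R := Num.sqrt (n1 * n2)%:R.
have s0 : 0 <= s by exact: sqrtr_ge0.
pose c := c1 + c2 * s.
have c0 : 0 <= c by rewrite addr_ge0// mulr_ge0.
have W_growth t : `|W t| <= c * (1 + `|X t|).
  apply: le_trans (normr_le_frob_norm _) _; apply: le_trans (Psi_growth _ _) _.
  have := ler_wpM2l c2_ge0 (frob_norm_le_normr (X t)); rewrite -/s.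
  have : 0 <= c1 * `|X t| by rewrite mulr_ge0.
  have : 0 <= c2 * s by rewrite mulr_ge0.
  by rewrite /c; lra.
have residual_small d : 0 < d -> \forall t \near \oo, r t <= d * (1 + `|X t|).
  move=> d0; pose C2 := (CG * c) ^+ 2.
  have C20 : 0 <= C2 by exact: sqr_ge0.
  have e1 : 0 < mu / 4 * d ^+ 4 / (Ce + 1).
    by rewrite divr_gt0 ?ltr_wpDl// mulr_gt0 ?exprn_gt0// divr_gt0.
  have e2 : 0 < mu / 4 * d ^+ 2 / (C2 + 1).
    by rewrite divr_gt0 ?ltr_wpDl// mulr_gt0 ?exprn_gt0// divr_gt0.
  have small e : 0 < e -> \forall t \near \oo, D t - D t.+1 <= e.
    move=> e0; move/cvgr0Pnorm_le/(_ e e0): d_cvg0; apply: filterS => t.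
    exact: le_trans (ler_norm _).
  apply: filterS2 (small _ e1) (small _ e2) => t h1 h2.
  have [dD dDJ] := step t.
  have r0 : 0 <= r t by exact: frob_norm_ge0.
  apply: (@small_relative_residual _ mu (D t - D t.+1) _ _ Ce C2) => //.
  - by rewrite lerDl.
  - have -> : mu / 2 * r t ^+ 4 = 2 * mu * (1 / 2 * r t ^+ 2) ^+ 2 by field.
    apply: le_trans dDJ _; apply: ler_wpM2l => //; apply: lerD => //.
    have y0 : 0 <= 1 + `|X t| by rewrite addr_ge0.
    rewrite /C2 -!exprMn lerXn2r ?nnegrE ?dual_norm_ge0 ?mulr_ge0//.
    apply: le_trans (GC _ _ _) _; rewrite -/(w t) -/(r t).
    apply: le_trans (ler_wpM2l _ (W_growth t)) _; first by rewrite mulr_ge0.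
    by rewrite le_eqVlt; apply/orP; left; apply/eqP; ring.
  - by move: h1; rewrite ler_pdivlMr ?ltr_wpDl//; lra.
  - by move: h2; rewrite ler_pdivlMr ?ltr_wpDl//; lra.
have [CXd CXd0 XdC] : exists2 C, 0 <= C & forall t, `|Xd t| <= C.
  apply: (@stable_recursion_bounded _ _ _ _ L_stable Xd (fun t => B (Ud t))
    (CB * Cu)) => [t|t]; first by rewrite Xd_rec.
  apply: le_trans (BC _) _; rewrite ler_wpM2l//.
  exact: le_trans (normr_le_frob_norm _) (UdC t).
pose E t := X t - Xd t.
have E_rec t : E t.+1 = L (E t) + w t.
  rewrite /E X_rec U_def Xd_rec /L /= /w /W mulmxBl !linearD !linearN /=.
  by apply/matrixP => i j; rewrite !mxE; ring.
have XE t : `|X t| <= `|E t| + CXd.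
  by have := ler_normD (E t) (Xd t); rewrite subrK; have := XdC t; lra.
have E_cvg0 : (fun t => `|E t|) @ \oo --> (0 : R).
  apply: (@stable_recursion_cvg0 _ _ _ _ L_stable E w (1 + CXd)) => //.
    by rewrite addr_ge0.
  move=> d d0; have := residual_small d d0; apply: filterS => t rt.
  apply: le_trans (normr_le_frob_norm _) _; apply: le_trans rt _.
  by rewrite ler_wpM2l ?(ltW d0)//; have := XE t; lra.
split=> //.
  have [M EM] : exists M : R, forall t, `|E t| <= M.
    have [M [_ EM]] := cvg_seq_bounded (cvgP _ E_cvg0).
    exists (M + 1) => t; have := EM (M + 1).
    by rewrite ltrDl => /(_ ltr01 t I) /=; rewrite normr_id.
  exists (s * (M + CXd)) => t; apply: le_trans (frob_norm_le_normr _) _.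
  by rewrite ler_wpM2l//; have := XE t; have := EM t; lra.
have sE_cvg0 : (fun t => s * `|E t|) @ \oo --> (0 : R).
  by rewrite -[X in _ --> X](mulr0 s); apply: cvgM => //; exact: cvg_cst.
apply: (squeeze_cvgr _ (cvg_cst _) sE_cvg0).
by apply: nearW => t; rewrite frob_norm_ge0 frob_norm_le_normr.
Qed.
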